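(* Let $A\in\mathbb{R}^{m\times n}$ with $m\ge 3$ have pairwise linearly independent rows $a_1^\top,\dots,a_m^\top$, let $b\in\mathbb{R}^m$ be such that $Ax=b$ is consistent, let $x^{(0)}\in\mathbb{R}^n$, and let $x^\star=A^\dagger b+(I-A^\dagger A)x^{(0)}$ be the orthogonal projection of $x^{(0)}$ onto the solution set of $Ax=b$. Put $$\rho_0=1-\frac{\sigma_{\min}^2(A)}{\|A\|_F^2},\qquad \rho_1=1-\frac{\sigma_{\min}^2(A)}{(1-\delta_{\min}^2)\gamma_1},\qquad \rho_2=1-\frac{\sigma_{\min}^2(A)}{(1-\delta_{\min}^2)\gamma_2}.$$ Let $\{x^{(k)}\}_{k\ge 0}$ be any iteration sequence generated by the GMIRK method from $x^{(0)}$ (for any admissible selection probabilities and any realization of the random indices $i_k$). Then $$\|x^{(1)}-x^\star\|_2^2\le \rho_0\,\|x^{(0)}-x^\star\|_2^2$$ and $$\|x^{(k)}-x^\star\|_2^2\le \rho_2^{\,k-2}\rho_1\rho_0\,\|x^{(0)}-x^\star\|_2^2,\qquad k=2,3,\dots,$$ for all such $k$ for which the iterate $x^{(k)}$ is generated (i.e. the method has not terminated earlier).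
   Context: Notation: $[m]=\{1,\dots,m\}$; $a_i\in\mathbb{R}^n$ is the transpose of the $i$-th row of $A$ and $b_i$ the $i$-th entry of $b$; $A^\dagger$ is the Moore-Penrose pseudoinverse; $\|A\|_F$ is the Frobenius norm; $\sigma_{\min}(A)$ is the smallest non-zero singular value of $A$. For $i\ne j$ the vectors $a_i,a_j$ are assumed linearly independent. Define $$\gamma_1=\max_{i\in[m]}\sum_{j\ne i}\|a_j\|_2^2,\qquad \gamma_2=\max_{i,j\in[m],\,i\ne j}\ \sum_{k\ne i,j}\|a_k\|_2^2,\qquad \delta_{\min}=\min_{i,j\in[m],\,i\ne j}\left|\left\langle \frac{a_i}{\|a_i\|_2},\frac{a_j}{\|a_j\|_2}\right\rangle\right| .$$ GMIRK method (greedy multi-step inertial randomized Kaczmarz). Put $\Gamma_0=\|A\|_F^2$, $\Gamma_1=\gamma_1$, and $\Gamma_k=\gamma_2$ for $k\ge2$. Starting from $x^{(0)}$, for $k=0,1,2,\dots$: if $Ax^{(k)}=b$, terminate (no further iterates are generated). Otherwise: (1) compute $\varepsilon_k=\frac12\left(\frac{1}{\|Ax^{(k)}-b\|_2^2}\max_{i\in[m]}\frac{|a_i^\top x^{(k)}-b_i|^2}{\|a_i\|_2^2}+\frac{1}{\Gamma_k}\right)$; (2) set $\mathcal{I}_k=\{i\in[m] : |a_i^\top x^{(k)}-b_i|^2\ge \varepsilon_k\|Ax^{(k)}-b\|_2^2\|a_i\|_2^2\}$; (3) select an index $i_k\in\mathcal{I}_k$ with $\mathrm{Prob}(i_k=i)=p_i^{(k)}$,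 where $p_i^{(k)}=0$ for $i\notin\mathcal{I}_k$, $p_i^{(k)}\ge0$ for $i\in\mathcal{I}_k$ and $\sum_{i\in\mathcal{I}_k}p_i^{(k)}=1$ (the probabilities are otherwise arbitrary; the selected index always lies in $\mathcal{I}_k$); (4) if $k=0$ set $w^{(0)}=x^{(0)}$; if $k\ge1$ set $$\beta_k=\frac{\langle a_{i_k},a_{i_{k-1}}\rangle\,(\langle a_{i_k},x^{(k)}\rangle-b_{i_k})}{\|a_{i_k}\|_2^2\|a_{i_{k-1}}\|_2^2-\langle a_{i_k},a_{i_{k-1}}\rangle^2},\qquad w^{(k)}=x^{(k)}+\beta_k a_{i_{k-1}};$$ (5) set $x^{(k+1)}=w^{(k)}-\frac{\langle a_{i_k},w^{(k)}\rangle-b_{i_k}}{\|a_{i_k}\|_2^2}a_{i_k}$. *)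

(* Defs.v *)
From mathcomp Require Import all_boot all_order all_algebra.
From mathcomp Require Import boolp classical_sets reals.

Set Implicit Arguments.
Unset Strict Implicit.
Unset Printing Implicit Defensive.
Import Order.TTheory GRing.Theory Num.Theory.
Local Open Scope ring_scope.

Section Euclidean.
Context {R : realType}.

Definition dot n (u v : 'cV[R]_n) : R := (u^T *m v) 0 0.

Definition norm2 n (u : 'cV[R]_n) : R := Num.sqrt (dot u u).

Definition normF m n (A : 'M[R]_(m, n)) : R :=
  Num.sqrt (\sum_i \sum_j A i j ^+ 2).

(* The i-th row of A as a column vector. *)
Definition avec m n (A : 'M[R]_(m, n)) (i : 'I_m) : 'cV[R]_n := (row i A)^T.

End Euclidean.

Section MoorePenrose.
Context {R : realType}.

Definition is_mp_inverse m n (A : 'M[R]_(m, n)) (X : 'M[R]_(n, m)) : Prop :=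
  [/\ A *m X *m A = A, X *m A *m X = X,
      (A *m X)^T = A *m X & (X *m A)^T = X *m A].

Lemma is_mp_inverse_unique m n (A : 'M[R]_(m, n)) (X Y : 'M[R]_(n, m)) :
  is_mp_inverse A X -> is_mp_inverse A Y -> X = Y.
Proof.
move=> [AXA XAX AX XA] [AYA YAY AY YA].
have eA : A *m X = A *m Y.
  have {1}-> : A *m X = A *m Y *m (A *m X) by rewrite mulmxA AYA.
  by rewrite -(trmxK (_ *m _)) trmx_mul AX AY mulmxA AXA AY.
have eB : X *m A = Y *m A.
  have {1}-> : X *m A = X *m A *m (Y *m A) by rewrite -mulmxA (mulmxA A) AYA.
  by rewrite -(trmxK (_ *m _)) trmx_mul XA YA -mulmxA (mulmxA A) AXA YA.
by rewrite -XAX -YAY eB -!mulmxA eA.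
Qed.

Lemma gram_unit r n (F : 'M[R]_(r, n)) : row_free F -> F *m F^T \in unitmx.
Proof.
move=> Ffree; rewrite -row_free_unit; apply: inj_row_free => v vFF.
set w := v *m F.
have ww0 : \sum_j w 0 j ^+ 2 = 0.
  have : (w *m w^T) 0 0 = 0 by rewrite trmx_mul mulmxA -(mulmxA v) vFF mul0mx mxE.
  rewrite mxE => ww0; rewrite -[RHS]ww0; apply: eq_bigr => j _.
  by rewrite [w^T _ _]mxE expr2.
apply: (row_free_inj Ffree); rewrite mul0mx -/w; apply/rowP => j.
move/eqP: ww0; rewrite psumr_eq0 => [/allP h|i _]; last exact: sqr_ge0.
have := h j (mem_index_enum j); rewrite sqrf_eq0 [RHS]mxE => H; by move/eqP: H.
Qed.

Lemma is_mp_inverse_exists m n (A : 'M[R]_(m, n)) :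
  exists X, is_mp_inverse A X.
Proof.
have [r [C [F [-> uC uF]]]] : exists r (C : 'M[R]_(m, r)) (F : 'M[R]_(r, n)),
    [/\ A = C *m F, C^T *m C \in unitmx & F *m F^T \in unitmx].
  exists (\rank A), (col_base A), (row_base A); split.
  - by rewrite mulmx_base.
  - rewrite -{2}[col_base A]trmxK; apply: gram_unit.
    by rewrite /row_free mxrank_tr; exact: col_base_full.
  - by apply: gram_unit; exact: row_base_free.
pose P := invmx (F *m F^T); pose Q := invmx (C^T *m C).
have PT : P^T = P by rewrite /P trmx_inv trmx_mul trmxK.
have QT : Q^T = Q by rewrite /Q trmx_inv trmx_mul trmxK.
pose X := F^T *m P *m Q *m C^T.
have AX : C *m F *m X = C *m Q *m C^T.
  rewrite /X !mulmxA -(mulmxA C F) -(mulmxA C _ P).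
  by rewrite mulmxV // mulmx1.
have XA : X *m (C *m F) = F^T *m P *m F.
  rewrite /X !mulmxA -(mulmxA _ C^T C) -(mulmxA _ Q (_ *m _)).
  by rewrite mulVmx // mulmx1.
exists X; split.
- rewrite AX !mulmxA -(mulmxA _ C^T C) -(mulmxA _ Q (_ *m _)).
  by rewrite mulVmx // mulmx1.
- rewrite XA /X !mulmxA -(mulmxA _ F F^T) -(mulmxA _ (F *m F^T) P).
  by rewrite mulmxV // mulmx1.
- by rewrite AX !trmx_mul trmxK QT mulmxA.
- by rewrite XA !trmx_mul trmxK PT mulmxA.
Qed.

Definition mp_inverse m n (A : 'M[R]_(m, n)) : 'M[R]_(n, m) :=
  xget 0 [set X | is_mp_inverse A X]%classic.

Lemma mp_inverseP m n (A : 'M[R]_(m, n)) : is_mp_inverse A (mp_inverse A).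
Proof. exact: (xgetPex 0 (is_mp_inverse_exists A)). Qed.

(* A^+ b + (I - A^+ A) x0 is the orthogonal projection of x0 onto the
   (nonempty) solution set of A x = b. *)
Lemma mp_inverse_proj m n (A : 'M[R]_(m, n)) (b : 'cV[R]_m) (x0 : 'cV[R]_n)
    (xs := mp_inverse A *m b + (1%:M - mp_inverse A *m A) *m x0) :
  (exists z, A *m z = b) ->
  A *m xs = b /\ forall y, A *m y = b -> dot (x0 - xs) (y - xs) = 0.
Proof.
case=> z Az; have [AXA XAX AX XA] := mp_inverseP A.
have Axs : A *m xs = b.
  rewrite /xs mulmxDr mulmxA -Az mulmxA AXA mulmxA mulmxBr mulmx1.
  by rewrite mulmxA AXA subrr mul0mx addr0.
split=> // y Ay.
have -> : x0 - xs = mp_inverse A *m A *m (x0 - z).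
  rewrite /xs -Az mulmxA mulmxBl mul1mx mulmxBr opprD opprB.
  by rewrite addrC -addrA subrK addrC.
rewrite /dot trmx_mul XA -!mulmxA [A *m _]mulmxBr Ay Axs subrr.
by rewrite !mulmx0 mxE.
Qed.

End MoorePenrose.

Section SingularValues.
Context {R : realType}.

Definition singular_value m n (A : 'M[R]_(m, n)) (s : R) : Prop :=
  0 <= s /\ eigenvalue (A^T *m A) (s ^+ 2).

(* There are finitely many singular values, so that the infimum is a minimum
   (see sigma_minP below); for A = 0 there is no non-zero singular value and
   the value is the default inf set0 = 0. *)
Definition sigma_min m n (A : 'M[R]_(m, n)) : R :=
  inf [set s | singular_value A s /\ s != 0]%classic.

Lemma sigma_minP m n (A : 'M[R]_(m, n)) :
  (exists s, singular_value A s /\ s != 0) ->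
  [/\ singular_value A (sigma_min A), sigma_min A != 0 &
      forall s, singular_value A s -> s != 0 -> sigma_min A <= s].
Proof.
case=> s1 [s1sv s1N0].
have pN0 : char_poly (A^T *m A) != 0 by apply/monic_neq0/char_poly_monic.
suff [t [tsv tN0] tmin] : exists2 t, singular_value A t /\ t != 0 &
    forall s, singular_value A s -> s != 0 -> t <= s.
  suff -> : sigma_min A = t by split.
  apply/eqP; rewrite eq_le; apply/andP; split.
    apply: ge_inf; last by split.
    by exists t => s [] ssv sN0; exact: tmin.
  by apply: lb_le_inf; [exists t | move=> s [] /=; exact: tmin].
(* descent on the number of non-zero singular values below s *)
have [k] : exists k, forall r : seq R, uniq r ->
    all (fun s => (s < s1) && `[< singular_value A s /\ s != 0 >]) r ->
    (size r < k)%N.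
  exists (size (char_poly (A^T *m A))) => r ur /allP hr.
  rewrite -(size_map (fun s => s ^+ 2)); apply: max_poly_roots => //.
    apply/allP=> _ /mapP[s /hr/andP[_ /asboolP[[_ sv] _]] ->].
    by rewrite -eigenvalue_root_char.
  rewrite map_inj_in_uniq // => s t /hr/andP[_ /asboolP[[s0 _] _]].
  move=> /hr/andP[_ /asboolP[[t0 _] _]] /eqP.
  by rewrite eqrXn2 // => /eqP.
elim: k s1 s1sv s1N0 => [|k IH] s1 s1sv s1N0 hk.
  by have := hk [::] isT isT.
have [[t [[tsv tN0] ts1]]|none] :=
    pselect (exists t, (singular_value A t /\ t != 0) /\ t < s1).
  apply: (IH t) => // r ur /allP hr.
  have := hk (t :: r); rewrite /= ltnS; apply.
    by rewrite ur andbT; apply/negP=> /hr; rewrite ltxx.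
  rewrite ts1 /=; apply/andP; split; first exact/asboolP.
  by apply/allP=> s /hr/andP[st ->]; rewrite (lt_trans st).
exists s1 => // s sv sN0; rewrite leNgt; apply/negP => ss1.
by apply: none; exists s.
Qed.

End SingularValues.

Section Constants.
Context {R : realType} {m n : nat}.
Implicit Types (A : 'M[R]_(m, n)).

(* In the maxima below all terms are nonnegative, hence the default value 0;
   in delta_min all terms are at most 1 (Cauchy-Schwarz), hence the default
   value 1.  The index ranges are nonempty as soon as 2 <= m. *)
Definition gamma1 A : R :=
  \big[Num.max/0]_(i < m) \sum_(j < m | j != i) norm2 (avec A j) ^+ 2.

Definition gamma2 A : R :=
  \big[Num.max/0]_(ij : 'I_m * 'I_m | ij.1 != ij.2)
     \sum_(k < m | (k != ij.1) && (k != ij.2)) norm2 (avec A k) ^+ 2.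

Definition normalize (u : 'cV[R]_n) : 'cV[R]_n := (norm2 u)^-1 *: u.

Definition delta_min A : R :=
  \big[Num.min/1]_(ij : 'I_m * 'I_m | ij.1 != ij.2)
     `|dot (normalize (avec A ij.1)) (normalize (avec A ij.2))|.

End Constants.

Section GMIRK.
Context {R : realType} {m n : nat}.
Variables (A : 'M[R]_(m, n)) (b : 'cV[R]_m).

Definition gmirk_Gamma (k : nat) : R :=
  match k with
  | 0%N => normF A ^+ 2
  | 1%N => gamma1 A
  | _ => gamma2 A
  end.

Definition gmirk_eps (k : nat) (x : 'cV[R]_n) : R :=
  2^-1 * ((norm2 (A *m x - b) ^+ 2)^-1 *
            \big[Num.max/0]_(i < m)
               (`|dot (avec A i) x - b i 0| ^+ 2 / norm2 (avec A i) ^+ 2)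
          + (gmirk_Gamma k)^-1).

Definition gmirk_set (k : nat) (x : 'cV[R]_n) : {set 'I_m} :=
  [set i | `|dot (avec A i) x - b i 0| ^+ 2 >=
           gmirk_eps k x * norm2 (A *m x - b) ^+ 2 * norm2 (avec A i) ^+ 2].

Definition gmirk_prob (k : nat) (x : 'cV[R]_n) (p : 'I_m -> R) : Prop :=
  [/\ forall i, i \notin gmirk_set k x -> p i = 0,
      forall i, i \in gmirk_set k x -> 0 <= p i
    & \sum_(i in gmirk_set k x) p i = 1].

(* i is the current row index, j the previous one *)
Definition gmirk_beta (i j : 'I_m) (x : 'cV[R]_n) : R :=
  dot (avec A i) (avec A j) * (dot (avec A i) x - b i 0) /
  (norm2 (avec A i) ^+ 2 * norm2 (avec A j) ^+ 2
   - dot (avec A i) (avec A j) ^+ 2).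

Definition gmirk_w (ix : nat -> 'I_m) (x : nat -> 'cV[R]_n) (k : nat) :
    'cV[R]_n :=
  if k is k'.+1 then x k + gmirk_beta (ix k) (ix k') (x k) *: avec A (ix k')
  else x k.

(* x^(k) is generated iff the method did not terminate at an earlier iterate *)
Definition gmirk_generated (x : nat -> 'cV[R]_n) (k : nat) : Prop :=
  forall l, (l < k)%N -> A *m x l <> b.

(* A realization of the method: p k are the selection probabilities and ix k
   the selected index at step k.  Past termination the values of p, ix and x
   are unconstrained and meaningless. *)
Record gmirk_run (x0 : 'cV[R]_n) (p : nat -> 'I_m -> R) (ix : nat -> 'I_m)
    (x : nat -> 'cV[R]_n) : Prop := GmirkRun {
  gmirk_init : x 0%N = x0;
  gmirk_probP : forall k, gmirk_generated x k.+1 -> gmirk_prob k (x k) (p k);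
  gmirk_index : forall k, gmirk_generated x k.+1 -> ix k \in gmirk_set k (x k);
  gmirk_step : forall k, gmirk_generated x k.+1 ->
    x k.+1 = gmirk_w ix x k
      - ((dot (avec A (ix k)) (gmirk_w ix x k) - b (ix k) 0)
         / norm2 (avec A (ix k)) ^+ 2) *: avec A (ix k)
}.

End GMIRK.

(* Main.v *)
Require Import Defs.
From mathcomp Require Import all_boot all_order all_algebra.
From mathcomp Require Import boolp classical_sets reals.
From mathcomp Require Import ring lra.

Set Implicit Arguments.
Unset Strict Implicit.
Unset Printing Implicit Defensive.
Import Order.TTheory GRing.Theory Num.Theory.
Local Open Scope ring_scope.

(** Write e_k = x_k - xs for the error and r_k = A e_k for the residual.

    Geometry of a step. After any step, the equation of the selected row
    holds. Hence for k >= 1 the inertial term is the one that makes x_(k+1)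
    the orthogonal projection of x_k onto the intersection of the two
    hyperplanes of the current row a and of the previous row c
    ([inertial_projection]). So both equations hold at x_(k+1), and by
    Pythagoras the squared error drops by exactly <a, e_k>^2 divided by the
    squared distance |a|^2 - <a, c>^2 / |c|^2 of a to the line of c. That
    squared distance is at most (1 - delta_min^2) |a|^2.

    Size of the residual. The threshold eps_k is the average of the largest
    relative residual and of 1 / Gamma_k. Since r_k vanishes at the last two
    selected rows, |r_k|^2 is at most the largest relative residual times the
    squared norms of the other rows, whose sum is at most Gamma_k. So any
    greedy row satisfies <a, e_k>^2 / |a|^2 >= |r_k|^2 / Gamma_k
    ([greedy_ratio]). In particular it has a non-zero residual, so it differs
    from the rows selected in the last two steps, which keeps the argument
    running.

    Spectral bound. The projection xs is chosen so that e_0 lies in the row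
    space of A, and the steps never leave it. On the row space
    |A e| >= sigma_min |e| ([sigma_min_bound]): the best constant in
    mu |e|^2 <= |A e|^2 is positive, and must be an eigenvalue of A^T A
    because otherwise it could be increased.

    Together these give |e_(k+1)|^2 <= rho |e_k|^2 with the rho of step k
    ([gmirk_step_contraction]). Multiplying these inequalities needs
    rho >= 0, which follows from the same inequality, because e_k is not zero
    as long as the method runs. *)

(** * Inner product *)

Section InnerProduct.
Context {R : realType}.
Implicit Types (a c s t : R).

Lemma dotE n (u v : 'cV[R]_n) : dot u v = \sum_i u i 0 * v i 0.
Proof. by rewrite /dot mxE; apply: eq_bigr => i _; rewrite mxE. Qed.

Lemma dotC n (u v : 'cV[R]_n) : dot u v = dot v u.
Proof. by rewrite !dotE; apply: eq_bigr => i _; rewrite mulrC. Qed.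

Lemma dotDr n (u v w : 'cV[R]_n) : dot u (v + w) = dot u v + dot u w.
Proof. by rewrite /dot mulmxDr mxE. Qed.

Lemma dotZr n a (u v : 'cV[R]_n) : dot u (a *: v) = a * dot u v.
Proof. by rewrite /dot -scalemxAr mxE. Qed.

Lemma dotNr n (u v : 'cV[R]_n) : dot u (- v) = - dot u v.
Proof. by rewrite /dot mulmxN mxE. Qed.

Lemma dotDl n (u v w : 'cV[R]_n) : dot (v + w) u = dot v u + dot w u.
Proof. by rewrite ![dot _ u]dotC dotDr. Qed.

Lemma dotZl n a (u v : 'cV[R]_n) : dot (a *: v) u = a * dot v u.
Proof. by rewrite ![dot _ u]dotC dotZr. Qed.

Lemma dotNl n (u v : 'cV[R]_n) : dot (- v) u = - dot v u.
Proof. by rewrite ![dot _ u]dotC dotNr. Qed.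

Definition dot_linE := (dotDl, dotNl, dotZl, dotDr, dotNr, dotZr).

Lemma dot_mul m n (M : 'M[R]_(m, n)) (u : 'cV[R]_n) (v : 'cV[R]_m) :
  dot (M *m u) v = dot u (M^T *m v).
Proof. by rewrite /dot trmx_mul mulmxA. Qed.

Lemma dot_ge0 n (u : 'cV[R]_n) : 0 <= dot u u.
Proof. by rewrite dotE sumr_ge0 // => i _; rewrite -expr2 sqr_ge0. Qed.

Lemma dot_eq0 n (u : 'cV[R]_n) : (dot u u == 0) = (u == 0).
Proof.
apply/eqP/eqP => [|->]; last by rewrite /dot mulmx0 mxE.
rewrite dotE => /eqP; rewrite psumr_eq0 => [/allP u0|i _].
  apply/colP => i; apply/eqP; rewrite mxE -sqrf_eq0 expr2.
  exact: u0 (mem_index_enum i).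
by rewrite -expr2 sqr_ge0.
Qed.

Lemma dot_gt0 n (u : 'cV[R]_n) : (0 < dot u u) = (u != 0).
Proof. by rewrite lt_def dot_eq0 dot_ge0 andbT. Qed.

Lemma norm2_sqr n (u : 'cV[R]_n) : norm2 u ^+ 2 = dot u u.
Proof. by rewrite sqr_sqrtr // dot_ge0. Qed.

(** Cauchy-Schwarz for an arbitrary positive semidefinite form, stated on its
    three values so that it applies to forms known to be positive only on a
    subspace. Homogeneity in both [s] and [t] covers [c = 0]. *)
Lemma psd_discriminant (a h c : R) :
  (forall s t, 0 <= s ^+ 2 * a + 2 * s * t * h + t ^+ 2 * c) ->
  h ^+ 2 <= a * c.
Proof.
move=> psd.
have c0 : 0 <= c.
  by have := psd 0 1; rewrite expr0n expr1n /= mul0r mulr0 !mul0r !add0r mul1r.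
have [c_gt0|c_le0] := ltP 0 c.
  have : 0 <= c * (a * c - h ^+ 2) 
    by have := psd c (- h); congr (_ <= _); ring.
  by rewrite pmulr_rge0 // subr_ge0.
have c_eq0 : c = 0 by apply/eqP; rewrite eq_le c_le0.
(* At s = 2h, t = -(a + 1) the form is 4ah^2 - 4(a + 1)h^2 = -4h^2. *)
by have := psd (2 * h) (- (a + 1)); rewrite c_eq0; lra.
Qed.

Lemma cauchy_schwarz n (u v : 'cV[R]_n) :
  dot u v ^+ 2 <= dot u u * dot v v.
Proof.
apply: psd_discriminant => s t.
have := dot_ge0 (s *: u + t *: v).
by rewrite !dot_linE (dotC v u); congr (_ <= _); ring.
Qed.

Lemma cauchy_schwarz_strict n (u v : 'cV[R]_n) :
  free [:: u; v] -> dot u v ^+ 2 < dot u u * dot v v.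
Proof.
rewrite free_cons span_seq1 seq1_free => /andP[uv v0].
have vv : 0 < dot v v by rewrite dot_gt0.
have : 0 < dot (dot v v *: u - dot u v *: v) (dot v v *: u - dot u v *: v).
  rewrite dot_gt0 subr_eq0; apply: contraNneq uv => e.
  apply/vlineP; exists ((dot v v)^-1 * dot u v).
  by rewrite -scalerA -e scalerA mulVf ?scale1r // gt_eqF.
rewrite !dot_linE (dotC v u).
(* The vector is |v|^2 times the component of u orthogonal to v. *)
set D := (X in 0 < X); suff -> : D = dot v v * (dot u u * dot v v - dot u v ^+ 2).
  by rewrite pmulr_rgt0 // subr_gt0.
by rewrite /D; ring.
Qed.

End InnerProduct.

(** * Rows and Frobenius norm *)

Section RowsAndFrobenius.
Context {R : realType} {m n : nat}.
Implicit Types (A : 'M[R]_(m, n)) (v : 'cV[R]_n).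

Lemma dot_avec A i v : dot (avec A i) v = (A *m v) i 0.
Proof. by rewrite /dot /avec trmxK -row_mul mxE. Qed.

Lemma avec_range A i : exists u, avec A i = A^T *m u.
Proof. by exists (delta_mx i 0); rewrite /avec tr_row colE. Qed.

Lemma dot_mulmxE A v :
  dot (A *m v) (A *m v) = \sum_i dot (avec A i) v ^+ 2.
Proof. by rewrite dotE; apply: eq_bigr => i _; rewrite dot_avec expr2. Qed.

Lemma normF_sqr A : normF A ^+ 2 = \sum_i norm2 (avec A i) ^+ 2.
Proof.
rewrite sqr_sqrtr.
  apply: eq_bigr => i _; rewrite norm2_sqr dotE.
  by apply: eq_bigr => j _; rewrite !mxE expr2.
by apply: sumr_ge0 => i _; apply: sumr_ge0 => j _; apply: sqr_ge0.
Qed.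

Lemma normF_bound A v : dot (A *m v) (A *m v) <= normF A ^+ 2 * dot v v.
Proof.
rewrite dot_mulmxE normF_sqr mulr_suml; apply: ler_sum => i _.
by rewrite norm2_sqr cauchy_schwarz.
Qed.

End RowsAndFrobenius.

(** * Smallest non-zero singular value *)

Section SmallestSingularValue.
Context {R : realType} {m n : nat}.
Implicit Types (A : 'M[R]_(m, n)) (mu : R).

Definition row_space_coercive A mu : Prop :=
  forall u : 'cV[R]_m,
    mu * dot (A^T *m u) (A^T *m u) <= dot (A *m (A^T *m u)) (A *m (A^T *m u)).

(** The pseudoinverse X satisfies X A v = v on the row space, so its Frobenius
    norm bounds |v| in terms of |A v|. *)
Lemma row_space_coercive_pos A : exists2 mu, 0 < mu & row_space_coercive A mu.
Proof.
have [AXA _ _ XA] := mp_inverseP A; set X := mp_inverse A in AXA XA.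
have XAAt : X *m A *m A^T = A^T by rewrite -{1}XA -trmx_mul mulmxA AXA.
have C0 : 0 < normF X ^+ 2 + 1 by rewrite ltr_wpDl // sqr_ge0.
exists (normF X ^+ 2 + 1)^-1 => [|u]; first by rewrite invr_gt0.
rewrite mulrC ler_pdivrMr // -{1 2}XAAt -!mulmxA.
apply: le_trans (normF_bound _ _) _; rewrite mulrC ler_wpM2l ?dot_ge0 //.
by rewrite lerDl.
Qed.

(** Let B be the form of M = A^T A - mu, positive semidefinite on the row
    space by assumption. If M is invertible then |v|^2 <= C |M v|^2, and
    Cauchy-Schwarz for B applied to v and M v gives |M v|^2 <= K B(v, v).
    So B is bounded below by |v|^2 / (C K), which is room to increase mu. *)
Lemma row_space_coercive_gap A mu : 0 <= mu ->
  row_space_coercive A mu -> ~~ eigenvalue (A^T *m A) mu ->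
  exists2 c, 0 < c & row_space_coercive A (mu + c).
Proof.
move=> mu0 cmu; rewrite /eigenvalue /eigenspace kermx_eq0 row_free_unit negbK.
set M := A^T *m A - mu%:M => Mu.
pose K := normF A ^+ 2 + 1; pose C := normF (invmx M) ^+ 2 + 1.
have K0 : 0 < K by rewrite ltr_wpDl // sqr_ge0.
have C0 : 0 < C by rewrite ltr_wpDl // sqr_ge0.
have MT : M^T = M by rewrite /M linearB /= trmx_mul trmxK tr_scalar_mx.
have BE (v w : 'cV_n) : dot (M *m v) w = dot (A *m v) (A *m w) - mu * dot v w.
  by rewrite dot_mul MT mulmxBl dotDr dotNr mul_scalar_mx dotZr -mulmxA [RHS]addrC
     addrC dot_mul.
exists (C * K)^-1 => [|u]; first by rewrite invr_gt0 mulr_gt0.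
set v := A^T *m u; set w := M *m v.
(* Cauchy-Schwarz for B is available on the row space only, so M v must lie
   in it. *)
have [t wE] : exists t, w = A^T *m t.
  exists (A *m v - mu *: u).
  by rewrite mulmxBr -scalemxAr /w mulmxBl mul_scalar_mx !mulmxA.
have Bv : 0 <= dot w v by rewrite BE subr_ge0 cmu.
have vw : dot v v <= C * dot w w.
  rewrite -{1 2}(mul1mx v) -(mulVmx Mu) -!mulmxA -/w.
  apply: le_trans (normF_bound _ _) _; rewrite ler_wpM2r ?dot_ge0 //.
  by rewrite /C lerDl.
have Bw : dot (M *m w) w <= K * dot w w.
  rewrite BE; have := normF_bound A w; have := mulr_ge0 mu0 (dot_ge0 w).
  by have := dot_ge0 w; rewrite /K; lra.
have cs : dot w w ^+ 2 <= dot w v * dot (M *m w) w.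
  have := BE v w; have := BE v v; rewrite -/w (BE w w) => -> wwE.
  rewrite [X in X ^+ 2]wwE; apply: psd_discriminant => a b.
  have := cmu (a *: u + b *: t).
  rewrite !(mulmxDr, =^~ scalemxAr) -/v -wE !dot_linE.
  by rewrite (dotC w v) (dotC (A *m w) (A *m v)) -subr_ge0; congr (_ <= _); ring.
have wB : dot w w <= K * dot w v.
  have [->|w0] := eqVneq (dot w w) 0; first by rewrite mulr_ge0 // ltW.
  have ww : 0 < dot w w by rewrite lt_def w0 dot_ge0.
  rewrite -(ler_pM2r ww) -expr2; apply: le_trans cs _.
  by have := ler_wpM2l Bv Bw; congr (_ <= _); ring.
have : dot v v / (C * K) <= dot w v.
  rewrite ler_pdivrMr ?mulr_gt0 //; apply: le_trans vw _.
  by have := ler_wpM2l (ltW C0) wB; congr (_ <= _); ring.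
by rewrite BE -/v; lra.
Qed.

(** The eigenvalue is the largest coercivity constant, which is positive by
    [row_space_coercive_pos] and cannot be increased. *)
Lemma row_space_coercive_eigenvalue A (u : 'cV[R]_m) : A^T *m u != 0 ->
  exists mu, [/\ 0 < mu, row_space_coercive A mu & eigenvalue (A^T *m A) mu].
Proof.
move=> u0; pose L := [set mu | row_space_coercive A mu]%classic.
have uu : 0 < dot (A^T *m u) (A^T *m u) by rewrite dot_gt0.
have [mu mu0 cmu] := row_space_coercive_pos A.
have supL : has_sup L.
  split; first by exists mu.
  exists (dot (A *m (A^T *m u)) (A *m (A^T *m u)) / dot (A^T *m u) (A^T *m u)).
  by move=> nu /(_ u); rewrite ler_pdivlMr.
have mu_sup : mu <= sup L by apply: sup_upper_bound.
have sup0 : 0 < sup L by apply: lt_le_trans mu0 mu_sup.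
have csup : row_space_coercive A (sup L).
  move=> t; have [tt|tt] := ltP 0 (dot (A^T *m t) (A^T *m t)).
    rewrite -ler_pdivlMr //; apply: sup_le_ub; first by exists mu.
    by move=> nu /(_ t); rewrite ler_pdivlMr.
  have -> : dot (A^T *m t) (A^T *m t) = 0 by apply/eqP; rewrite eq_le tt dot_ge0.
  by rewrite mulr0 dot_ge0.
exists (sup L); split=> //; apply: contraT => not_eig.
have [c c0 cc] := row_space_coercive_gap (ltW sup0) csup not_eig.
have : sup L + c <= sup L by apply: sup_upper_bound.
by rewrite gerDl leNgt c0.
Qed.

(** The square root of the eigenvalue found above is a non-zero singular
    value, so [sigma_min A] is at most that root. *)
Lemma sigma_min_bound A : row_space_coercive A (sigma_min A ^+ 2).
Proof.
move=> u; have [->|u0] := eqVneq (A^T *m u) 0.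
  by rewrite mulmx0 /dot !mulmx0 !mxE mulr0.
have [mu [mu0 cmu eig]] := row_space_coercive_eigenvalue u0.
have svmu : singular_value A (Num.sqrt mu).
  by split; [apply: sqrtr_ge0 | rewrite sqr_sqrtr // ltW].
have mu_neq0 : Num.sqrt mu != 0 by rewrite gt_eqF // sqrtr_gt0.
have [] := sigma_minP (ex_intro _ _ (conj svmu mu_neq0)).
move=> [s0 _] _ /(_ _ svmu mu_neq0) le_s.
apply: le_trans (cmu u); apply: ler_wpM2r; first exact: dot_ge0.
by rewrite -[leRHS]sqr_sqrtr ?(ltW mu0) // lerXn2r // nnegrE sqrtr_ge0.
Qed.

End SmallestSingularValue.

(** * One step of the method *)

Section GreedyInertialStep.
Context {R : realType}.

(** When [e] is already orthogonal to [c], the step computed with momentum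
    along [c] removes from [e] its component along the part of [a] orthogonal
    to [c]; the decrease is Pythagoras for that component. *)
Lemma inertial_projection n (a c e : 'cV[R]_n)
    (D := dot a a * dot c c - dot a c ^+ 2)
    (w := e + (dot a c * dot a e / D) *: c)
    (e' := w - (dot a w / dot a a) *: a) :
  0 < dot a a -> 0 < D -> dot c e = 0 ->
  [/\ dot a e' = 0, dot c e' = 0 &
      dot e' e' = dot e e - dot a e ^+ 2 * dot c c / D].
Proof.
move=> aa0 D0 ce.
have aaN : dot a a != 0 by rewrite gt_eqF.
have DN : D != 0 by rewrite gt_eqF.
have ae' : dot a e' = 0 by rewrite dotDr dotNr dotZr mulfVK // subrr.
have aw : dot a w = dot a e * dot a a * dot c c / D.
  by rewrite /w !dot_linE; rewrite /D in DN *; field.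
have ce' : dot c e' = 0.
  rewrite dotDr dotNr dotZr aw /w !dot_linE ce (dotC c a).
  by rewrite /D in DN *; field; apply/andP.
(* e' - e lies in the span of a and c, hence <e', e'> = <e, e'>. *)
split=> //; rewrite {1}/e' {1}/w !(dotDl, dotNl, dotZl) ae' ce' !mulr0 addr0 subr0.
rewrite /e' aw /w !dot_linE (dotC e c) ce (dotC e a).
by rewrite /D in DN *; field; apply/andP.
Qed.

Context (m n : nat) (A : 'M[R]_(m, n)) (b : 'cV[R]_m).

(** [S] is a set of rows whose equations hold at [x]: such rows do not
    contribute to the residual, so only the norms of the other rows enter the
    comparison of |A x - b|^2 with the largest relative residual M. Then
    |A x - b|^2 <= M Gamma, and the average of M and |A x - b|^2 / Gamma that
    defines the greedy set is at least |A x - b|^2 / Gamma. *)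
Lemma greedy_ratio (k : nat) (x xs : 'cV[R]_n) (S : {set 'I_m}) (i : 'I_m) :
  (forall j, 0 < dot (avec A j) (avec A j)) -> A *m xs = b -> A *m x <> b ->
  (forall j, j \in S -> dot (avec A j) (x - xs) = 0) ->
  \sum_(j | j \notin S) norm2 (avec A j) ^+ 2 <= gmirk_Gamma A k ->
  0 < gmirk_Gamma A k -> i \in gmirk_set A b k x ->
  dot (A *m (x - xs)) (A *m (x - xs)) * dot (avec A i) (avec A i)
    <= gmirk_Gamma A k * dot (avec A i) (x - xs) ^+ 2.
Proof.
move=> a0 Axs Axb solved sumS G0.
set G := gmirk_Gamma A k in sumS G0 *; set N := dot (A *m _) _.
have rE j : dot (avec A j) x - b j 0 = dot (avec A j) (x - xs).
  by rewrite dotDr dotNr !dot_avec Axs.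
have NE : norm2 (A *m x - b) ^+ 2 = N by rewrite norm2_sqr -Axs -mulmxBr.
have N0 : 0 < N.
  rewrite -NE norm2_sqr dot_gt0 subr_eq0; exact/eqP.
rewrite inE /gmirk_eps NE rE norm2_sqr -/G real_normK ?num_real //.
set M := \big[Num.max/0]_(j < m) _ => i_greedy.
have leM j : dot (avec A j) (x - xs) ^+ 2 <= M * norm2 (avec A j) ^+ 2.
  rewrite norm2_sqr -ler_pdivrMr //.
  apply: le_trans (le_bigmax_cond _ _ (isT : predT j)).
  by rewrite /= rE norm2_sqr real_normK ?num_real.
have NMG : N <= M * G.
  rewrite {1}/N dot_mulmxE (bigID (mem S)) /= big1 => [|j /solved ->].
    rewrite add0r.
    apply: (@le_trans _ _ (M * \sum_(j | j \notin S) norm2 (avec A j) ^+ 2)).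
      by rewrite mulr_sumr; apply: ler_sum => j _; exact: leM.
    apply: ler_wpM2l => //.
    by rewrite -(pmulr_lge0 _ (a0 i)) -norm2_sqr (le_trans _ (leM i)) ?sqr_ge0.
  by rewrite expr0n.
have := ler_wpM2l (ltW G0) i_greedy; apply: le_trans.
have -> : G * (2^-1 * (N^-1 * M + G^-1) * N * dot (avec A i) (avec A i)) =
    2^-1 * (M * G + N) * dot (avec A i) (avec A i).
  by field; rewrite !gt_eqF.
rewrite ler_wpM2r ?dot_ge0 //; lra.
Qed.

End GreedyInertialStep.

(** * Coherence of the rows *)

Section Coherence.
Context {R : realType} {m n : nat}.
Implicit Types (A : 'M[R]_(m, n)).

Lemma delta_min_ge0 A : 0 <= delta_min A.
Proof. by apply: le_bigmin => [|ij _]; rewrite ?ler01 ?normr_ge0. Qed.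

Lemma delta_min_le A i j : i != j ->
  0 < dot (avec A i) (avec A i) -> 0 < dot (avec A j) (avec A j) ->
  delta_min A ^+ 2 * (dot (avec A i) (avec A i) * dot (avec A j) (avec A j))
    <= dot (avec A i) (avec A j) ^+ 2.
Proof.
move=> ij ai aj; rewrite -ler_pdivlMr ?mulr_gt0 //.
have := @bigmin_le_cond _ _ _ 1 (i, j) (fun ij => ij.1 != ij.2)
  (fun ij => `|dot (normalize (avec A ij.1)) (normalize (avec A ij.2))|) ij.
rewrite -/(delta_min A) /= => le_d.
have := lerXn2r 2 (delta_min_ge0 A) (normr_ge0 _) le_d.
rewrite real_normK ?num_real // /normalize !dot_linE !exprMn !exprVn !norm2_sqr.
by congr (_ <= _); field; rewrite !gt_eqF.
Qed.

End Coherence.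

(** * Runs of the method *)

Section Run.
Context {R : realType} (m n : nat) (A : 'M[R]_(m, n)) (b : 'cV[R]_m).

(** The rows whose equations hold at the k-th iterate by construction. *)
Definition last_indices (ix : nat -> 'I_m) (k : nat) : {set 'I_m} :=
  match k with
  | 0 => finset.set0
  | 1 => [set ix 0%N]
  | k'.+2 => [set ix k'.+1; ix k']
  end.

(** The first step has no momentum, hence no coherence factor. *)
Definition contraction_rate (k : nat) : R :=
  1 - sigma_min A ^+ 2 /
        ((if k is 0 then 1 else 1 - delta_min A ^+ 2) * gmirk_Gamma A k).

(** The last clause keeps two rows excluded from the residual from [k = 2] on,
    as required for the bound by [gamma2]. *)
Definition error_invariant (ix : nat -> 'I_m) (k : nat) (e : 'cV[R]_n) : Prop :=
  [/\ exists u, e = A^T *m u,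
      forall i, i \in last_indices ix k -> dot (avec A i) e = 0 &
      (1 < k)%N -> ix k.-1 != ix k.-2].

Lemma mem_last_indices ix k : ix k \in last_indices ix k.+1.
Proof. by case: k => [|k]; rewrite !inE eqxx. Qed.

Lemma last_indices_sum_le (ix : nat -> 'I_m) k :
  ((1 < k)%N -> ix k.-1 != ix k.-2) ->
  \sum_(i | i \notin last_indices ix k) norm2 (avec A i) ^+ 2
    <= gmirk_Gamma A k.
Proof.
case: k => [_|[_|k /(_ isT) /= ij]] /=.
- by rewrite normF_sqr; under eq_bigl do rewrite inE.
- under eq_bigl do rewrite inE; rewrite /gamma1.
  exact: (@le_bigmax _ _ _ 0
    (fun i : 'I_m => \sum_(j < m | j != i) norm2 (avec A j) ^+ 2)).
- under eq_bigl do rewrite !inE negb_or.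
  exact: (@le_bigmax_cond _ _ _ 0 (ix k.+1, ix k) (fun ij => ij.1 != ij.2)
    (fun ij => \sum_(j < m | (j != ij.1) && (j != ij.2)) norm2 (avec A j) ^+ 2)).
Qed.

Hypothesis hm : (3 <= m)%N.
Hypothesis hA : forall i j : 'I_m, i != j -> free [:: avec A i; avec A j].

Lemma exists_notin (S : {set 'I_m}) : (#|S| <= 2)%N -> exists j, j \notin S.
Proof.
move=> S2; have /card_gt0P[j] : (0 < #|~: S|)%N.
  by rewrite cardsCs finset.setCK card_ord subn_gt0 (leq_ltn_trans S2).
by rewrite inE; exists j.
Qed.

Lemma row_sqr_gt0 i : 0 < dot (avec A i) (avec A i).
Proof.
have [j] : exists j, j \notin [set i] by apply: exists_notin; rewrite cards1.
rewrite inE eq_sym => /hA; rewrite free_cons => /andP[ij _].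
by rewrite dot_gt0; apply: contraNneq ij => ->; rewrite mem0v.
Qed.

(** At least one of the three or more rows is not among the last two selected,
    and it is non-zero. *)
Lemma Gamma_gt0 (ix : nat -> 'I_m) k :
  ((1 < k)%N -> ix k.-1 != ix k.-2) -> 0 < gmirk_Gamma A k.
Proof.
move=> /last_indices_sum_le; apply: lt_le_trans.
have [j jS] : exists j, j \notin last_indices ix k.
  apply: exists_notin; case: k => [|[|k]]; rewrite /= ?cards0 ?cards1 //.
  by rewrite cards2; case: eqP.
rewrite (bigD1 j) //= norm2_sqr ltr_wpDr ?row_sqr_gt0 //.
by apply: sumr_ge0 => i _; exact: sqr_ge0.
Qed.

(** Two linearly independent rows have a cosine of modulus less than 1. *)
Lemma delta_min_lt1 : 0 < 1 - delta_min A ^+ 2.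
Proof.
have [i _] : exists i : 'I_m, i \notin finset.set0.
  by apply: exists_notin; rewrite cards0.
have [j] : exists j, j \notin [set i] by apply: exists_notin; rewrite cards1.
rewrite inE eq_sym => ij.
have ai := row_sqr_gt0 i; have aj := row_sqr_gt0 j.
have := le_lt_trans (delta_min_le ij ai aj) (cauchy_schwarz_strict (hA ij)).
by rewrite -[ltRHS]mul1r ltr_pM2r ?mulr_gt0 // subr_gt0.
Qed.

Context (x0 xs : 'cV[R]_n) (p : nat -> 'I_m -> R) (ix : nat -> 'I_m)
  (x : nat -> 'cV[R]_n).
Hypothesis hrun : gmirk_run A b x0 p ix x.
Hypothesis Axs : A *m xs = b.

(** The greedy row has a non-zero residual, so it is new; this makes the
    projection onto two hyperplanes well defined and re-establishes the
    invariant. The three inequalities (coherence, greedy ratio, spectral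
    bound) then chain to the rate. *)
Lemma gmirk_step_contraction k :
  error_invariant ix k (x k - xs) -> gmirk_generated A b x k.+1 ->
  error_invariant ix k.+1 (x k.+1 - xs) /\
  norm2 (x k.+1 - xs) ^+ 2 <= contraction_rate k * norm2 (x k - xs) ^+ 2.
Proof.
move=> [[u eu] solved distinct] gen.
have Axk : A *m x k <> b by apply: gen.
have G0 := Gamma_gt0 distinct.
set e := x k - xs in eu solved *; set i := ix k; set a := avec A i.
have := greedy_ratio row_sqr_gt0 Axs Axk solved (last_indices_sum_le distinct) G0
  (gmirk_index hrun gen).
rewrite -/e -/i -/a => greedy.
have Ae0 : 0 < dot (A *m e) (A *m e).
  by rewrite dot_gt0 /e mulmxBr Axs subr_eq0; apply/eqP.
have a0 : 0 < dot a a := row_sqr_gt0 i.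
have ae0 : dot a e != 0.
  apply: contraTneq greedy => ->.
  by rewrite expr0n mulr0 -ltNge mulr_gt0.
have i_new : i \notin last_indices ix k.
  by apply: contraNN ae0 => /solved ->.
have res (y : 'cV[R]_n) : dot a y - b i 0 = dot a (y - xs).
  by rewrite dotDr dotNr !dot_avec Axs.
have [v av] := avec_range A i.
have sig : sigma_min A ^+ 2 * dot e e <= dot (A *m e) (A *m e).
  by rewrite eu; apply: sigma_min_bound.
(* c is the coherence factor: 1 for the first step, 1 - delta_min^2 later. *)
have rate c e2 : 0 < c -> e2 <= dot e e - dot a e ^+ 2 / (c * dot a a) ->
    e2 <= (1 - sigma_min A ^+ 2 / (c * gmirk_Gamma A k)) * dot e e.
  move=> c0 /le_trans; apply; rewrite mulrBl mul1r lerD2l lerN2 mulrAC.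
  rewrite ler_pdivrMr ?mulr_gt0 // [leRHS]mulrAC ler_pdivlMr ?mulr_gt0 //.
  have := le_trans (ler_wpM2r (ltW a0) sig) greedy.
  by move=> /(ler_wpM2l (ltW c0)); congr (_ <= _); ring.
have := gmirk_step hrun gen; rewrite res -/i -/a !norm2_sqr.
case: k => [|k] /= in e i a gen distinct G0 solved eu greedy Ae0 a0 ae0 i_new
  res v av sig rate Axk * => xS.
- have eS : x 1%N - xs = e - (dot a e / dot a a) *: a by rewrite xS addrAC.
  have aeS : dot a (x 1%N - xs) = 0.
    by rewrite eS dotDr dotNr dotZr mulfVK ?subrr ?gt_eqF.
  split; first split=> //.
  + exists (u - (dot a e / dot a a) *: v).
    by rewrite eS eu /a av mulmxBr -scalemxAr.
  + by move=> j; rewrite inE => /eqP->.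
  + apply: (rate 1) => //.
    rewrite {1}eS dotDl dotNl dotZl aeS eS dotDr dotNr dotZr (dotC e a).
    by rewrite mul1r mulr0 subr0 mulrAC expr2.
- set j := ix k; set c := avec A j.
  have ij : i != j by apply: contraNneq i_new => ->; exact: mem_last_indices.
  have cc0 : 0 < dot c c := row_sqr_gt0 j.
  have D0 : 0 < dot a a * dot c c - dot a c ^+ 2.
    by rewrite subr_gt0 cauchy_schwarz_strict // hA.
  have ce : dot c e = 0 by apply: solved; exact: mem_last_indices.
  have [] := inertial_projection a0 D0 ce.
  set w := e + _ *: c => aeS ceS eeS.
  have wE : gmirk_w A b ix x k.+1 - xs = w.
    by rewrite /= /gmirk_beta res !norm2_sqr addrAC.
  have eS : x k.+2 - xs = w - (dot a w / dot a a) *: a.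
    by rewrite xS -/(gmirk_w A b ix x k.+1) wE addrAC wE.
  rewrite -eS in aeS ceS eeS.
  have [v' cv'] := avec_range A j.
  split; first split=> //.
  + rewrite eS /w eu /a av /c cv' !scalemxAr -!mulmxDr -mulmxBr.
    by eexists.
  + by move=> l; rewrite !inE => /orP[]/eqP->.
  + apply: (rate (1 - delta_min A ^+ 2)); first exact: delta_min_lt1.
    rewrite eeS lerD2l lerN2 -mulrA ler_wpM2l ?sqr_ge0 //.
    rewrite ler_pdivlMr // mulrC ler_pdivrMr ?mulr_gt0 ?delta_min_lt1 //.
    have := delta_min_le ij a0 cc0; rewrite -/a -/c; lra.
Qed.

Lemma gmirk_error_bound k :
  (exists u, x0 - xs = A^T *m u) -> gmirk_generated A b x k ->
  norm2 (x k - xs) ^+ 2 <=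
    \prod_(0 <= l < k) contraction_rate l * norm2 (x0 - xs) ^+ 2.
Proof.
move=> e0_range gen.
suff [] : error_invariant ix k (x k - xs) /\ norm2 (x k - xs) ^+ 2 <=
    \prod_(0 <= l < k) contraction_rate l * norm2 (x0 - xs) ^+ 2 by [].
elim: k gen => [_|k IH gen].
  rewrite (gmirk_init hrun) big_geq // mul1r; split=> //; split=> // i.
  by rewrite inE.
have [|inv le_k] := IH; first by move=> l lk; apply: gen; apply: ltnW.
have [invS leS] := gmirk_step_contraction inv gen.
split=> //.
have ek0 : 0 < norm2 (x k - xs) ^+ 2.
  rewrite norm2_sqr dot_gt0 subr_eq0; apply/eqP => xk.
  by apply: (gen k) => //; rewrite xk.
(* A rate can only be negative if the error vanishes, but then the method has
   stopped. *)
have rate0 : 0 <= contraction_rate k.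
  by rewrite -(pmulr_lge0 _ ek0) (le_trans _ leS) // sqr_ge0.
apply: le_trans leS _.
by rewrite big_nat_recr //= [X in _ <= X * _]mulrC -mulrA ler_wpM2l.
Qed.

End Run.

Theorem theorem2p4 (R : realType) (m n : nat) (A : 'M[R]_(m, n))
    (b : 'cV[R]_m) (x0 : 'cV[R]_n)
    (p : nat -> 'I_m -> R) (ix : nat -> 'I_m) (x : nat -> 'cV[R]_n)
    (hm : (3 <= m)%N)
    (hA : forall i j : 'I_m, i != j -> free [:: avec A i; avec A j])
    (hb : exists z : 'cV[R]_n, A *m z = b)
    (hrun : gmirk_run A b x0 p ix x) :
  let xs := mp_inverse A *m b + (1%:M - mp_inverse A *m A) *m x0 in
  let rho0 := 1 - sigma_min A ^+ 2 / normF A ^+ 2 in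
  let rho1 := 1 - sigma_min A ^+ 2 / ((1 - delta_min A ^+ 2) * gamma1 A) in
  let rho2 := 1 - sigma_min A ^+ 2 / ((1 - delta_min A ^+ 2) * gamma2 A) in
  (gmirk_generated A b x 1 ->
     norm2 (x 1%N - xs) ^+ 2 <= rho0 * norm2 (x0 - xs) ^+ 2) /\
  (forall k : nat, (2 <= k)%N -> gmirk_generated A b x k ->
     norm2 (x k - xs) ^+ 2
       <= rho2 ^+ (k - 2) * rho1 * rho0 * norm2 (x0 - xs) ^+ 2).
Proof.
move=> xs rho0 rho1 rho2.
have [Axs _] := mp_inverse_proj x0 hb; rewrite -/xs in Axs.
have e0_range : exists u, x0 - xs = A^T *m u.
  case: hb => z Az; have [_ _ _ XA] := mp_inverseP A.
  (* x0 - xs = A^+ A (x0 - z), and A^+ A is symmetric. *)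
  exists ((mp_inverse A)^T *m (x0 - z)).
  rewrite mulmxA -trmx_mul XA /xs -Az mulmxA mulmxBl mul1mx mulmxBr.
  by rewrite opprD opprB addrCA [x0 + _]addrC subrK addrC.
have rate0 : contraction_rate A 0 = rho0 by rewrite /contraction_rate /= mul1r.
split=> [gen|[|[|k]] // _ gen].
  have := gmirk_error_bound hm hA hrun Axs e0_range gen.
  by rewrite big_nat1 rate0.
have := gmirk_error_bound hm hA hrun Axs e0_range gen.
rewrite big_nat_recl // big_nat_recl // rate0.
rewrite (eq_bigr (fun=> rho2)) // prodr_const_nat !subn0 subSS.
by rewrite subn1 /= [rho0 * _]mulrC [_ * rho2 ^+ _]mulrC.
Qed.
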